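(* Let $*$ be a continuous t-norm on $[0,1]$ and let $\varphi\in\Delta$ be a distance distribution. Then every $\xi\in\Delta$ with $\xi\leq\varphi$ is a diagonal on $\varphi$ in the quantale $\Delta_*=(\Delta,\otimes_*,\kappa_{0,1})$ if, and only if, $\varphi$ is a one-step function.
   Context: A continuous t-norm $*$ is a continuous, associative, commutative binary operation on $[0,1]$, monotone in each variable, with unit $1$. A distance distribution is a map $\varphi:[0,\infty]\to[0,1]$ with $\varphi(t)=\bigvee_{s<t}\varphi(s)$ for all $t\in[0,\infty]$ (the usual order on $[0,\infty]$; the empty join in $[0,1]$ is $0$, so $\varphi(0)=0$). $\Delta$ is the complete lattice of all distance distributions with the pointwise order: $\varphi\leq\psi$ iff $\varphi(t)\leq\psi(t)$ for all $t\in[0,\infty]$. For $p\in[0,\infty)$ and $a\in[0,1]$, the one-step function $\kappa_{p,a}\in\Delta$ is given by $\kappa_{p,a}(t)=0$ if $t\leq p$ and $\kappa_{p,a}(t)=a$ if $t>p$. A one-step function is a distance distribution of the form $\kappa_{p,a}$ for some $p\in[0,\infty)$, $a\in[0,1]$. The convolution of $\varphi,\psi\in\Delta$ is $(\varphi\otimes_*\psi)(t)=\bigvee_{r+s=t}\varphi(r)*\psi(s)$ for $t\in[0,\infty]$ ($r,s\in[0,\infty]$, with $p+\infty=\infty+p=\infty$). $\Delta_*=(\Delta,\otimes_*,\kappa_{0,1})$ is a commutative and integral quantale (i.e., $\otimes_*$ is a commutative associative operation preserving arbitrary suprema in each variable, whose unit $\kappa_{0,1}$ is the top element). Its implication $\Rightarrow_*$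 is determined by $\varphi\otimes_*\psi\leq\xi\iff\psi\leq\varphi\Rightarrow_*\xi$. $\xi\in\Delta$ is a diagonal on $\varphi$ in $\Delta_*$ if $\varphi\otimes_*(\varphi\Rightarrow_*\xi)=\xi$; equivalently, there exists $\psi\in\Delta$ with $\varphi\otimes_*\psi=\xi$. *)

(* Defs.v *)
From HB Require Import structures.
From mathcomp Require Import all_boot all_order all_algebra.
From mathcomp Require Import mathcomp_extra boolp classical_sets reals
  constructive_ereal interval_inference topology normedtype.

Set Implicit Arguments.
Unset Strict Implicit.
Unset Printing Implicit Defensive.

Import Order.TTheory GRing.Theory Num.Theory.
Import numFieldNormedType.Exports.

Local Open Scope classical_set_scope.
Local Open Scope ring_scope.

(* The operation is total on R; only its values on [0, 1] are constrained, and
   only those are ever used. *)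
Record continuous_tnorm (R : realType) := ContinuousTnorm {
  tnorm :> R -> R -> R ;
  tnorm_itv : {in `[0, 1] &, forall x y, tnorm x y \in `[0, 1]} ;
  tnormC : {in `[0, 1] &, commutative tnorm} ;
  tnormA : {in `[0, 1] & &, associative tnorm} ;
  tnorm_mono : {in `[0, 1] & &, forall x x' y,
    x <= x' -> tnorm x y <= tnorm x' y} ;
  tnorm1 : {in `[0, 1], right_id 1 tnorm} ;
  tnorm_continuous : {within `[0, 1]%classic `*` `[0, 1]%classic,
    continuous (fun z : R * R => tnorm z.1 z.2)}
}.

(* [sup set0 = 0], so on subsets of [0, 1] the real [sup] is the join of the
   complete lattice [0, 1], the empty join included.  The type {nonneg \bar R}
   is [0, +oo] with +oo included. *)
Record distance_distribution (R : realType) := DistanceDistribution {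
  dd_fun :> {nonneg \bar R} -> R ;
  dd_itv : forall t, dd_fun t \in `[0, 1] ;
  dd_left : forall t : {nonneg \bar R},
    dd_fun t = sup [set dd_fun s | s in [set s | (s%:num < t%:num)%E]]
}.

Section Order.
Variable R : realType.
Implicit Types (A B : set R) (t : {nonneg \bar R}).

Definition dd_le (phi psi : distance_distribution R) :=
  forall t, phi t <= psi t.

Lemma dd_eq (phi psi : distance_distribution R) : phi =1 psi -> phi = psi.
Proof.
case: phi => f f01 fl; case: psi => g g01 gl /= /funext fg.
by case: _ / fg in g01 gl *; congr DistanceDistribution; exact: Prop_irrelevance.
Qed.

Lemma sup01_ub A a : (forall x, A x -> x \in `[0, 1]) -> A a -> a <= sup A.
Proof.
move=> A01 Aa; apply: ub_le_sup => //.
by exists 1 => x /A01; rewrite in_itv => /andP[].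
Qed.

Lemma sup01_le A c : 0 <= c -> (forall x, A x -> x <= c) -> sup A <= c.
Proof.
move=> c0 Ac; have [->|/set0P A0] := eqVneq A set0; first by rewrite sup0.
exact: ge_sup.
Qed.

Lemma sup01_itv A : (forall x, A x -> x \in `[0, 1]) -> sup A \in `[0, 1].
Proof.
move=> A01; rewrite in_itv /=; apply/andP; split; last first.
  by apply: sup01_le => // x /A01; rewrite in_itv => /andP[].
have [->|/set0P [a Aa]] := eqVneq A set0; first by rewrite sup0.
by apply: le_trans (sup01_ub A01 Aa); move: (A01 _ Aa); rewrite in_itv => /andP[].
Qed.

Lemma dd_leftP (f : {nonneg \bar R} -> R) :
  (forall t, f t \in `[0, 1]) ->
  (forall s t, (s%:num < t%:num)%E -> f s <= f t) ->
  (forall t c, 0 <= c -> (forall s, (s%:num < t%:num)%E -> f s <= c) ->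
    f t <= c) ->
  forall t, f t = sup [set f s | s in [set s | (s%:num < t%:num)%E]].
Proof.
move=> f01 fm fl t; apply/eqP; rewrite eq_le; apply/andP; split.
  have S01 x : [set f s | s in [set s | (s%:num < t%:num)%E]] x ->
    x \in `[0, 1] by move=> [s _ <-].
  apply: fl => [|s st].
    by move: (sup01_itv S01); rewrite in_itv => /andP[].
  by apply: sup01_ub => //; exists s.
apply: sup01_le => [|_ [s /= st <-]]; last exact: fm.
by move: (f01 t); rewrite in_itv => /andP[].
Qed.

Lemma dd_ge0 (phi : distance_distribution R) t : 0 <= phi t.
Proof. by move: (dd_itv phi t); rewrite in_itv => /andP[]. Qed.

Lemma dd_mono (phi : distance_distribution R) s t :
  (s%:num < t%:num)%E -> phi s <= phi t.
Proof.
move=> st; rewrite (dd_left phi t); apply: sup01_ub; last by exists s.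
by move=> _ [u _ <-]; exact: dd_itv.
Qed.

Lemma dd_left_le (phi : distance_distribution R) t c : 0 <= c ->
  (forall s, (s%:num < t%:num)%E -> phi s <= c) -> phi t <= c.
Proof.
move=> c0 pc; rewrite (dd_left phi t).
by apply: sup01_le => // _ [s /= st <-]; exact: pc.
Qed.

Section Join.
Variable F : set (distance_distribution R).

Definition join_fun t := sup [set (psi : distance_distribution R) t | psi in F].

Fact join_set_itv t x :
  [set (psi : distance_distribution R) t | psi in F] x -> x \in `[0, 1].
Proof. by move=> [psi _ <-]; exact: dd_itv. Qed.

Fact join_itv t : join_fun t \in `[0, 1].
Proof. by apply: sup01_itv; exact: join_set_itv. Qed.

Fact join_fun_ge0 t : 0 <= join_fun t.
Proof. by move: (join_itv t); rewrite in_itv => /andP[]. Qed.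

Fact join_left t :
  join_fun t = sup [set join_fun s | s in [set s | (s%:num < t%:num)%E]].
Proof.
apply: (dd_leftP join_itv) => [s u su|u c c0 uc].
  apply: sup01_le => [|_ [psi Fpsi <-]]; first exact: join_fun_ge0.
  apply: (le_trans (dd_mono psi su)).
  by apply: (sup01_ub (@join_set_itv u)); exists psi.
apply: sup01_le => // _ [psi Fpsi <-]; apply: dd_left_le => // s su.
by apply: le_trans (uc s su); apply: (sup01_ub (@join_set_itv s)); exists psi.
Qed.

Definition dd_join := DistanceDistribution join_itv join_left.

Lemma dd_join_ub psi : F psi -> dd_le psi dd_join.
Proof. by move=> Fpsi t; apply: (sup01_ub (@join_set_itv t)); exists psi. Qed.

Lemma dd_join_le xi : (forall psi, F psi -> dd_le psi xi) -> dd_le dd_join xi.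
Proof.
move=> Fxi t; apply: sup01_le; first exact: dd_ge0.
by move=> _ [psi /Fxi + <-]; exact.
Qed.

End Join.

Section Kappa.
Variables (p : {nonneg R}) (a : {i01 R}).

Definition kappa_fun t : R := if (t%:num <= p%:num%:E)%E then 0 else a%:num.

Fact kappa_itv t : kappa_fun t \in `[0, 1].
Proof.
by rewrite /kappa_fun; case: ifP => _; rewrite in_itv /= ?lexx ?ler01 ?ge0 ?le1.
Qed.

Fact kappa_left t :
  kappa_fun t = sup [set kappa_fun s | s in [set s | (s%:num < t%:num)%E]].
Proof.
apply: (dd_leftP kappa_itv) => [s u su|u c c0 uc]; rewrite /kappa_fun.
  case: ifP => [_|sp]; first by case: ifP.
  by case: ifP => // up; rewrite (le_trans (ltW su) up) in sp.
case: ifPn => //; rewrite -ltNge => pu.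
have [r pr ru] : exists2 r : R, p%:num < r & (r%:E < u%:num)%E.
  case: u pu {uc} => -[r| |] /= _ pu.
  - move: pu; rewrite lte_fin => pr; exists ((p%:num + r) / 2).
      by rewrite midf_lt.
    by rewrite lte_fin midf_lt.
  - by exists (p%:num + 1); rewrite ?ltrDl ?ltr01// ltry.
  - by [].
have r0 : 0 <= r by rewrite (le_trans _ (ltW pr)).
have := uc ((NngNum r0)%:num%:E)%:itv ru.
by rewrite /kappa_fun ifF// lee_fin /= leNgt pr.
Qed.

Definition kappa := DistanceDistribution kappa_itv kappa_left.

End Kappa.

Definition one_step (phi : distance_distribution R) :=
  exists (p : {nonneg R}) (a : {i01 R}), phi = kappa p a.

End Order.

Section Convolution.
Variables (R : realType) (T : continuous_tnorm R).
Implicit Types (A B : set R) (t : {nonneg \bar R}).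
Implicit Types phi psi xi : distance_distribution R.

Lemma tnorm_mono2 : {in `[0, 1] &, forall x x' : R,
  {in `[0, 1] &, forall y y', x <= x' -> y <= y' -> T x y <= T x' y'}}.
Proof.
move=> x x' x01 x'01 y y' y01 y'01 xx' yy'.
apply: (le_trans (tnorm_mono T x01 x'01 y01 xx')).
by rewrite !(tnormC T x'01)//; apply: tnorm_mono.
Qed.

Lemma tnorm_sup_le A y c : (forall x, A x -> x \in `[0, 1]) -> y \in `[0, 1] ->
  0 <= c -> (forall x, A x -> T x y <= c) -> T (sup A) y <= c.
Proof.
move=> A01 y01 c0 Ac.
have i0 : (0 : R) \in `[0, 1] by rewrite in_itv /= lexx ler01.
have i1 : (1 : R) \in `[0, 1] by rewrite in_itv /= lexx ler01.
have [->|/set0P A0] := eqVneq A set0.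
  rewrite sup0 (le_trans _ c0)// -[leRHS](tnorm1 T i0).
  by apply: tnorm_mono2 => //; move: y01; rewrite in_itv => /andP[].
rewrite leNgt; apply/negP => cT.
have s01 : sup A \in `[0, 1] by exact: sup01_itv.
have hA : has_sup A.
  by split=> //; exists 1 => x /A01; rewrite in_itv => /andP[].
have /subspace_continuousP /(_ (sup A, y)) cont := @tnorm_continuous R T.
have /cont {}cont : (`[0, 1]%classic `*` `[0, 1]%classic) (sup A, y) by split.
have := cont [set z | c < z] (open_nbhs_nbhs (conj (@open_gt R c) cT)).
rewrite nbhs_simpl /= => /nbhs_ballP [e /= e0 be].
have [a Aa ae] := sup_adherent e0 hA.
have : c < T a y.
  apply: (be (a, y)) => /=; last by split=> //=; exact: A01.
  split=> /=; last exact: ballxx.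
  rewrite /ball /= ger0_norm; first by rewrite ltrBlDl -ltrBlDr.
  by rewrite subr_ge0; exact: sup01_ub.
by rewrite ltNge Ac.
Qed.

Lemma tnorm_sup_le2 A B c : (forall x, A x -> x \in `[0, 1]) ->
  (forall x, B x -> x \in `[0, 1]) -> 0 <= c ->
  (forall x y, A x -> B y -> T x y <= c) -> T (sup A) (sup B) <= c.
Proof.
move=> A01 B01 c0 ABc.
have sB := sup01_itv B01.
apply: tnorm_sup_le => // x Ax; rewrite (tnormC T (A01 _ Ax))//.
apply: tnorm_sup_le => // [|y By]; first exact: A01.
by rewrite (tnormC T (B01 _ By)) ?A01//; exact: ABc.
Qed.

Lemma nng_ereal (x : \bar R) : (0 <= x)%E ->
  exists w : {nonneg \bar R}, w%:num = x.
Proof.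
move=> x0.
have xS : Itv.spec (@ext_num_sem R) (Itv.Real `[0%Z, +oo[) x.
  by apply/and3P; split; rewrite /= ?bnd_simp// /Order.comparable x0.
by exists (Itv.mk xS).
Qed.

Lemma nng_add_shift (r v s u : {nonneg \bar R}) :
  (s%:num < u%:num)%E -> (r%:num + v%:num = s%:num)%E ->
  exists2 w : {nonneg \bar R}, (v%:num < w%:num)%E &
    (r%:num + w%:num = u%:num)%E.
Proof.
move=> su rv.
have rfin : r%:num%E \is a fin_num.
  rewrite ge0_fin_numE//; apply: le_lt_trans (lt_le_trans su (leey _)).
  by rewrite -rv leeDl.
have rEu : (r%:num + (u%:num - r%:num) = u%:num)%E by rewrite addeC subeK.
have d0 : (0 <= u%:num - r%:num)%E.
  by rewrite sube_ge0 ?rfin// (le_trans _ (ltW su))// -rv leeDl.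
have [w wE] := nng_ereal d0.
by exists w; rewrite wE// lteBrDl// rv.
Qed.

Section Conv.
Variables phi psi : distance_distribution R.

Definition conv_set t := [set T (phi rs.1) (psi rs.2) | rs in
  [set rs : {nonneg \bar R} * {nonneg \bar R} |
    (rs.1%:num + rs.2%:num = t%:num)%E]].

Definition conv_fun t := sup (conv_set t).

Fact conv_set_itv t x : conv_set t x -> x \in `[0, 1].
Proof. by move=> [rs _ <-]; apply: tnorm_itv; exact: dd_itv. Qed.

Fact conv_itv t : conv_fun t \in `[0, 1].
Proof. by apply: sup01_itv; exact: conv_set_itv. Qed.

Fact conv_fun_ge0 t : 0 <= conv_fun t.
Proof. by move: (conv_itv t); rewrite in_itv => /andP[]. Qed.

Fact conv_left t :
  conv_fun t = sup [set conv_fun s | s in [set s | (s%:num < t%:num)%E]].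
Proof.
apply: (dd_leftP conv_itv) => [s u su|u c c0 uc].
  apply: sup01_le => [|_ [[r v] /= rv <-]]; first exact: conv_fun_ge0.
  have [w vw rw] := nng_add_shift su rv.
  apply: (@le_trans _ _ (T (phi r) (psi w))).
    by apply: tnorm_mono2; rewrite ?dd_itv// dd_mono.
  by apply: (sup01_ub (@conv_set_itv u)); exists (r, w).
apply: sup01_le => // _ [[r v] /= rv <-].
rewrite (dd_left phi r) (dd_left psi v).
apply: tnorm_sup_le2 => //.
- by move=> _ [s _ <-]; exact: dd_itv.
- by move=> _ [s _ <-]; exact: dd_itv.
- move=> _ _ [r' /= r'r <-] [v' /= v'v <-].
  have lt : (r'%:num + v'%:num < u%:num)%E by rewrite -rv; exact: lteD.
  have [w wE] := nng_ereal (adde_ge0 (ge0e r') (ge0e v')).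
  rewrite -wE in lt; apply: le_trans (uc _ lt).
  by apply: (sup01_ub (@conv_set_itv _)); exists (r', v').
Qed.

Definition conv := DistanceDistribution conv_itv conv_left.

End Conv.

Definition imp phi xi := dd_join [set psi | dd_le (conv phi psi) xi].

Lemma conv_impP phi psi xi :
  dd_le (conv phi psi) xi <-> dd_le psi (imp phi xi).
Proof.
split=> [le|le t]; first exact: dd_join_ub.
apply: sup01_le => [|_ [[r s] /= rs <-]]; first exact: dd_ge0.
have := tnorm_mono2 (dd_itv phi r) (dd_itv phi r) (dd_itv psi s)
  (dd_itv (imp phi xi) s) (lexx _) (le s).
move=> /le_trans; apply; rewrite tnormC ?dd_itv//.
apply: tnorm_sup_le; rewrite ?dd_itv ?dd_ge0//.
  by move=> _ [ps _ <-]; exact: dd_itv.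
move=> _ [ps /= ple <-]; apply: le_trans (ple t).
rewrite tnormC ?dd_itv//; apply: sup01_ub; last by exists (r, s).
by move=> _ [rs' _ <-]; apply: tnorm_itv; exact: dd_itv.
Qed.

Definition diagonal_on phi xi := conv phi (imp phi xi) = xi.

End Convolution.

(* Main.v *)
Require Import Defs.
From mathcomp Require Import all_boot all_order all_algebra.
From mathcomp Require Import boolp classical_sets reals constructive_ereal
  interval_inference topology normedtype realfun.
From mathcomp Require Import lra.

(** Write [a * b] for the t-norm, [oo] for the infinite time and [kappa q b] for
    the step of height [b] at [q].

    A one-step function [kappa p a] has all its minorants as diagonals because
    a continuous t-norm is divisible: [xi x <= a] can be written [a * c], and
    then [kappa (x - p) c] convolves with [kappa p a] to [kappa x (xi x)], which
    lies below [xi] and recovers its value just after [x]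
    ([one_step_diagonal]).

    Conversely, let all minorants of [phi] be diagonals and let [a] be the value
    of [phi] at [oo].  It is enough to test one-step minorants: whenever
    [kappa q b <= phi], some [psi] satisfies [phi (x) psi = kappa q b], where
    [(x)] is convolution ([diagonal_kappa]).  Two uses of this finish the proof.

    - If [phi] takes the value [a] at a finite time, let [q] be the infimum of
      such times and factor [kappa q a].  The height [a] right after [q] can
      only come from values of [phi] after or just before [q], so that
      [a * psi h = a] for every [h > 0].  By divisibility [psi h] then fixes
      every value of [phi], so for [r < q] the value
      [phi r = phi r * psi (q - r)] is at most [kappa q a q = 0].  Hence
      [phi = kappa q a] ([attained_one_step]).

    - The value [a] is always attained ([diagonal_attained]).  If it were not,
      take [q] with [b := phi q > 0] and factor [kappa q b] with [psi]; then
      [psi oo] multiplies both [a] and the smaller [phi (q + 1)] to [b].  This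
      failure of cancellation yields [e < a] with [b * e = b]
      ([tnorm_unit_between]).  As [a] is not attained, there is a later [q']
      with [phi q'] above both [e] and [phi (q + 1)].  Factor
      [kappa q' (phi q')] with [psi'].  Its height at [q' + 1] needs
      [u + v = q' + 1] with [phi u > phi (q + 1)], so [u > q + 1], and with
      [psi' v >= e].  Then [phi (u - 1) * psi' v >= b * e = b > 0], although
      [(u - 1) + v = q'] is a time at which [kappa q' (phi q')] vanishes. *)

Set Implicit Arguments.
Unset Strict Implicit.
Unset Printing Implicit Defensive.

Import Order.TTheory GRing.Theory Num.Theory.
Import numFieldNormedType.Exports.

Local Open Scope classical_set_scope.
Local Open Scope ring_scope.

(** * Divisibility and units of a continuous t-norm *)

Section TNorm.
Variables (R : realType) (T : continuous_tnorm R).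
Implicit Types a b c x y : R.

Lemma zero_in01 : (0 : R) \in `[0, 1].
Proof. by rewrite in_itv /= lexx ler01. Qed.

Lemma one_in01 : (1 : R) \in `[0, 1].
Proof. by rewrite in_itv /= lexx ler01. Qed.

Lemma in01_ge0 x : x \in `[0, 1] -> 0 <= x.
Proof. by rewrite in_itv => /andP[]. Qed.

Lemma in01_le1 x : x \in `[0, 1] -> x <= 1.
Proof. by rewrite in_itv => /andP[]. Qed.

Lemma tnorm_le_l x y : x \in `[0, 1] -> y \in `[0, 1] -> T x y <= x.
Proof.
move=> x01 y01; rewrite -[leRHS](tnorm1 T x01).
by apply: tnorm_mono2; rewrite ?one_in01 ?in01_le1.
Qed.

Lemma tnorm_le_r x y : x \in `[0, 1] -> y \in `[0, 1] -> T x y <= y.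
Proof. by move=> x01 y01; rewrite tnormC//; exact: tnorm_le_l. Qed.

Lemma tnorm0l y : y \in `[0, 1] -> T 0 y = 0.
Proof.
move=> y01; apply/eqP; rewrite eq_le tnorm_le_l ?zero_in01//=.
by apply: in01_ge0; rewrite tnorm_itv ?zero_in01.
Qed.

Lemma tnorm0r x : x \in `[0, 1] -> T x 0 = 0.
Proof. by move=> x01; rewrite tnormC ?zero_in01// tnorm0l. Qed.

Lemma tnorm_section_continuous a : a \in `[0, 1] ->
  {within `[0, 1]%classic, continuous (T a)}.
Proof.
move=> a01; apply/subspace_continuousP => x x01.
have /subspace_continuousP /(_ (a, x)) := @tnorm_continuous R T.
have ax : (`[0, 1]%classic `*` `[0, 1]%classic) (a, x) by split.
move=> /(_ ax) cont; apply/cvgrPdist_lt => e e0.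
have /cvgrPdist_lt /(_ e e0) := cont.
move=> /nbhs_ballP[d /= d0 dP]; apply/nbhs_ballP; exists d => //= y xy y01.
by apply: (dP (a, y)) => //; split=> //; exact: ballxx.
Qed.

(** By the intermediate value theorem, since [T a 0 = 0] and [T a 1 = a]. *)
Lemma tnorm_div a b : a \in `[0, 1] -> b \in `[0, 1] -> b <= a ->
  exists2 c, c \in `[0, 1] & T a c = b.
Proof.
move=> a01 b01 ba; apply: IVT; first exact: ler01.
  exact: tnorm_section_continuous.
by rewrite tnorm0r// tnorm1// min_l ?max_r ?in01_ge0 ?ba.
Qed.

(** By divisibility, [x] is a multiple of [y]. *)
Lemma tnorm_fixed_le x y c : x \in `[0, 1] -> y \in `[0, 1] ->
  c \in `[0, 1] -> x <= y -> T y c = y -> T x c = x.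
Proof.
move=> x01 y01 c01 xy yc; have [d d01 <-] := tnorm_div y01 x01 xy.
by rewrite (tnormC T y01)// -tnormA// yc.
Qed.

(** The units of [b] are upward closed; were their infimum not a unit, the
    values of [T b] strictly between [T b (inf S)] and [b] would be reached
    neither on its left nor on its right. *)
Lemma tnorm_least_unit b : b \in `[0, 1] ->
  exists e, [/\ e \in `[0, 1], T b e = b &
    forall x, x \in `[0, 1] -> T b x = b -> e <= x].
Proof.
move=> b01; pose S := [set x | x \in `[0, 1] /\ T b x = b].
have S1 : S 1 by split; [exact: one_in01|exact: tnorm1].
have Slb : lbound S 0 by move=> x [/in01_ge0].
have Sinf : has_inf S by split; [exists 1|exists 0].
have lbS x : S x -> inf S <= x by move=> Sx; apply: ge_inf => //; exists 0.
have e01 : inf S \in `[0, 1].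
  by rewrite in_itv /= lbS// andbT; apply: lb_le_inf => //; exists 1.
exists (inf S); split=> // [|x x01 bx]; last exact: lbS.
apply/eqP; rewrite eq_le tnorm_le_l//= leNgt; apply/negP => lt.
have Te01 := tnorm_itv T b01 e01.
pose v := (T b (inf S) + b) / 2.
have v01 : v \in `[0, 1].
  move: (in01_ge0 Te01) (in01_le1 b01) lt; rewrite in_itv /= /v => ? ? ?.
  by apply/andP; split; lra.
have vb : v < b by rewrite midf_lt.
have [x x01 bx] := tnorm_div b01 v01 (ltW vb).
have [xe|ex] := leP x (inf S).
  suff : v <= T b (inf S) by rewrite leNgt midf_lt.
  by rewrite -bx; exact: tnorm_mono2.
have xe0 : 0 < x - inf S by rewrite subr_gt0.
have [y [y01 by_] yx] := inf_adherent xe0 Sinf.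
suff : b <= v by rewrite leNgt vb.
rewrite -bx -[leLHS]by_; apply: tnorm_mono2 => //.
by rewrite ltW// (lt_le_trans yx)// addrC subrK.
Qed.

(** Where cancellation fails, [b] has a unit below [a]; this stands in for the
    ordinal sum decomposition of continuous t-norms.  Writing [a' = T a g]
    makes [g] a unit of [b].  If the least unit [e] of [b] were at least [a],
    then minimality would give [T e g = e], whence [T a g = a]. *)
Lemma tnorm_unit_between a a' b c :
  a \in `[0, 1] -> a' \in `[0, 1] -> b \in `[0, 1] -> c \in `[0, 1] ->
  a' < a -> T a c = b -> T a' c = b ->
  exists e, [/\ e \in `[0, 1], T b e = b & e < a].
Proof.
move=> a01 a'01 b01 c01 a'a ac a'c.
have [g g01 ag] := tnorm_div a01 a'01 (ltW a'a).
have bg : T b g = b.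
  by rewrite -[in LHS]ac -tnormA// (tnormC T c01)// tnormA// ag.
have [e [e01 be emin]] := tnorm_least_unit b01.
exists e; split=> //; rewrite ltNge; apply/negP => ae.
have eg : T e g = e.
  apply/eqP; rewrite eq_le tnorm_le_l//=; apply: emin.
    exact: tnorm_itv.
  by rewrite tnormA// be.
by move: a'a; rewrite -ag (tnorm_fixed_le a01 e01)// ltxx.
Qed.

End TNorm.

(** * Distance distributions at finite times *)

Section Time.
Variable R : realType.
Implicit Types (a c p q x y : R) (r s t : {nonneg \bar R}).
Implicit Types (phi psi xi : distance_distribution R).

(** The absolute value makes the embedding of finite times total; only
    nonnegative arguments matter. *)
Definition time x : {nonneg \bar R} := (`|x|%:E)%:itv.

Lemma timeE x : 0 <= x -> (time x)%:num%E = x%:E.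
Proof. by move=> x0 /=; rewrite ger0_norm. Qed.

Lemma time_infty : exists t : {nonneg \bar R}, t%:num%E = +oo%E.
Proof. by apply: nng_ereal. Qed.

Lemma timeP t : t%:num%E = +oo%E \/ exists2 x : R, 0 <= x & t = time x.
Proof.
case E : (t%:num)%E => [x| |].
- have x0 : 0 <= x by rewrite -lee_fin -E ge0e.
  by right; exists x => //; apply: val_inj; rewrite /= ger0_norm.
- by left.
- by have : (0 <= t%:num)%E by []; rewrite E leeNy_eq.
Qed.

Lemma dd_homo phi s t : (s%:num <= t%:num)%E -> phi s <= phi t.
Proof.
rewrite le_eqVlt => /orP[/eqP st|]; last exact: dd_mono.
by have -> : s = t by exact: val_inj.
Qed.

Lemma dd_homo_time phi x y : 0 <= x -> x <= y -> phi (time x) <= phi (time y).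
Proof.
by move=> x0 xy; apply: dd_homo; rewrite !timeE ?(le_trans x0).
Qed.

Lemma dd_left_gt phi t c : 0 <= c -> c < phi t ->
  exists x, [/\ 0 <= x, (x%:E < t%:num)%E & c < phi (time x)].
Proof.
move=> c0 ct; apply/not_existsP => H; move: ct.
rewrite ltNge; apply/negP/negPn/dd_left_le => // s st.
rewrite leNgt; apply/negP => cs.
have [soo|[x x0 sx]] := timeP s.
  by move: st; rewrite soo ltNge leey.
by apply: (H x); rewrite -sx; split=> //; rewrite -(timeE x0) -sx.
Qed.

(** Interface to [kappa] with plain real parameters instead of the signed
    subtypes of its arguments. *)
Lemma kappaP p a : 0 <= p -> a \in `[0, 1] ->
  exists k : distance_distribution R, [/\ one_step k,
    forall t, (t%:num <= p%:E)%E -> k t = 0 &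
    forall t, (p%:E < t%:num)%E -> k t = a].
Proof.
move=> p0 a01.
exists (kappa (NngNum p0) (Itv01 (in01_ge0 a01) (in01_le1 a01))); split.
- by eexists; eexists.
- by move=> t tp; rewrite /= /kappa_fun /= tp.
- by move=> t; rewrite /= /kappa_fun /= ltNge => /negbTE ->.
Qed.

(** * Convolution at finite times *)

Variable T : continuous_tnorm R.

Lemma conv_ge phi psi r s t : (r%:num + s%:num = t%:num)%E ->
  T (phi r) (psi s) <= conv T phi psi t.
Proof.
by move=> rs; apply: sup01_ub; [exact: conv_set_itv|exists (r, s)].
Qed.

Lemma conv_ge_time phi psi x y : 0 <= x -> 0 <= y ->
  T (phi (time x)) (psi (time y)) <= conv T phi psi (time (x + y)).
Proof. by move=> x0 y0; apply: conv_ge; rewrite !timeE ?addr_ge0. Qed.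

Lemma conv_gt phi psi x c : 0 <= x -> 0 <= c ->
  c < conv T phi psi (time x) ->
  exists u v : R, [/\ 0 <= u, 0 <= v, u + v = x &
    c < T (phi (time u)) (psi (time v))].
Proof.
move=> x0 c0 /sup_gt[|_ [[r s] /= rs <-] lt].
  exists (T (phi (time x)) (psi (time 0))), (time x, time 0) => //=.
  by rewrite normr0 adde0 ger0_norm.
have [roo|[u u0 ru]] := timeP r.
  by move: rs; rewrite roo; have : (0 <= s%:num)%E by []; case: (s%:num%E).
have [soo|[v v0 sv]] := timeP s; first by move: rs; rewrite soo ru.
exists u, v; split => //.
- by move: rs; rewrite ru sv /= !ger0_norm// => -[].
- by rewrite -ru -sv.
Qed.


(** * Minorants of one-step functions *)

(** Only [xi <= phi (x) (phi => xi)] is at stake, and by left continuity it is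
    enough to bound [xi x] for finite [x < t].  If [x <= p] this value is [0];
    otherwise [kappa (x - p) c], with [T a c = xi x], lies below [phi => xi]. *)
Lemma one_step_diagonal phi xi : one_step phi -> dd_le xi phi ->
  diagonal_on T phi xi.
Proof.
move=> [p [a ->]] xile; apply: dd_eq => t; apply/eqP; rewrite eq_le.
have -> : conv T (kappa p a) (imp T (kappa p a) xi) t <= xi t.
  exact: ((conv_impP T _ _ _).2 (fun=> lexx _) t).
rewrite andTb leNgt; apply/negP => /dd_left_gt[|x [x0 xt]].
  exact: dd_ge0.
apply/negP; rewrite -leNgt.
have [xp|px] := leP x p%:num.
  apply: (le_trans (xile _)).
  by rewrite /= /kappa_fun timeE// lee_fin xp conv_fun_ge0.
have a01 : a%:num \in `[0, 1] by rewrite in_itv /= ge0 le1.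
have xia : xi (time x) <= a%:num.
  apply: (le_trans (xile _)).
  by rewrite /= /kappa_fun timeE// lee_fin (lt_geF px).
have [c c01 acx] := tnorm_div T a01 (dd_itv xi _) xia.
have xp0 : 0 <= x - p%:num by rewrite subr_ge0 ltW.
have [k [_ k0 kc]] := kappaP xp0 c01.
have kimp : dd_le k (imp T (kappa p a) xi).
  apply/conv_impP => u; apply: sup01_le; first exact: dd_ge0.
  move=> _ [[r v] /= rvu <-]; rewrite /kappa_fun.
  case: ifPn => [_|]; first by rewrite tnorm0l ?dd_itv// dd_ge0.
  rewrite -ltNge => pr.
  have [vx|xv] := leP (v%:num)%E (x - p%:num)%:E.
    by rewrite k0// tnorm0r// dd_ge0.
  rewrite kc// acx; apply: dd_mono; rewrite timeE// -rvu.
  have -> : x = p%:num + (x - p%:num) by rewrite addrC subrK.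
  by rewrite EFinD; exact: lteD.
have [y [xy yt]] : exists y, x < y /\ (y%:E <= t%:num)%E.
  have [too|[y y0 ty]] := timeP t.
    by exists (x + 1); rewrite ltrDl too leey.
  by exists y; split; [move: xt|]; rewrite ty timeE.
have y0 : 0 <= y by rewrite ltW// (le_lt_trans x0).
apply: (@le_trans _ _ (conv T (kappa p a) (imp T (kappa p a) xi) (time y)));
  last by apply: dd_homo; rewrite timeE.
(* Sharing the slack [y - x] evenly puts both arguments strictly beyond the
   steps at [p] and [x - p]. *)
pose d := (y - x) / 2.
have d0 : 0 < d by rewrite divr_gt0// subr_gt0.
have pd0 : 0 <= p%:num + d by rewrite addr_ge0 ?(ltW d0).
have xd0 : 0 <= x - p%:num + d by rewrite addr_ge0 ?(ltW d0).
have -> : y = (p%:num + d) + (x - p%:num + d) by rewrite /d; lra.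
apply: le_trans (conv_ge_time _ _ pd0 xd0).
rewrite -acx; apply: tnorm_mono2 => //; try exact: dd_itv.
  by rewrite /= /kappa_fun timeE// lee_fin gerDl (lt_geF d0).
apply: le_trans (kimp _); rewrite kc// timeE// lte_fin.
by rewrite ltrDl.
Qed.

(** * Functions all of whose minorants are diagonals *)

Lemma diagonal_kappa phi q b :
  (forall xi, dd_le xi phi -> diagonal_on T phi xi) ->
  0 <= q -> b \in `[0, 1] ->
  (forall t, (q%:E < t%:num)%E -> b <= phi t) ->
  exists psi, [/\ one_step (conv T phi psi),
    forall t, (t%:num <= q%:E)%E -> conv T phi psi t = 0 &
    forall t, (q%:E < t%:num)%E -> conv T phi psi t = b].
Proof.
move=> diag q0 b01 bphi; have [k [k1 k0 kb]] := kappaP q0 b01.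
have /diag kE : dd_le k phi.
  move=> t; have [tq|qt] := leP (t%:num)%E q%:E; first by rewrite k0// dd_ge0.
  by rewrite kb// bphi.
by exists (imp T phi k); rewrite kE.
Qed.

(** The factor [psi] of the step at the first time of maximality satisfies
    [phi x0 * psi h = phi x0] for all [h > 0], so it cannot reduce the values of
    [phi], whereas the convolution vanishes up to [inf S]. *)
Lemma attained_one_step phi x0 :
  (forall xi, dd_le xi phi -> diagonal_on T phi xi) ->
  0 <= x0 -> (forall t, phi t <= phi (time x0)) -> one_step phi.
Proof.
move=> diag x00 phimax.
pose S := [set x | 0 <= x /\ phi (time x) = phi (time x0)].
have Sx0 : S x0 by [].
have Slb : lbound S 0 by move=> x [].
have Sinf : has_inf S by split; [exists x0|exists 0].
have q0 : 0 <= inf S by apply: lb_le_inf => //; exists x0.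
have qphi t : ((inf S)%:E < t%:num)%E -> phi (time x0) <= phi t.
  have [too _|[y y0 ->]] := timeP t.
    by apply: dd_homo; rewrite too leey.
  rewrite timeE// lte_fin -subr_gt0 => qy.
  have [x [xx0 <-] xy] := inf_adherent qy Sinf.
  by apply: dd_homo_time => //; rewrite ltW// (lt_le_trans xy)// addrC subrK.
have [psi [cpsi1 cpsi0 cpsia]] := diagonal_kappa diag q0 (dd_itv phi _) qphi.
suff -> : phi = conv T phi psi by [].
apply: dd_eq => t; have [tq|qt] := leP (t%:num)%E (inf S)%:E; last first.
  by rewrite cpsia//; apply/eqP; rewrite eq_le phimax qphi.
rewrite cpsi0//; apply/eqP; rewrite eq_le dd_ge0 andbT.
apply: dd_left_le => // s /lt_le_trans /(_ tq).
have [->|[r r0 ->]] := timeP s; first by rewrite ltNge leey.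
rewrite timeE// lte_fin => rq.
pose h := inf S - r; have h0 : 0 < h by rewrite subr_gt0.
have unit_h : T (phi (time x0)) (psi (time h)) = phi (time x0).
  apply/eqP; rewrite eq_le tnorm_le_l ?dd_itv//= leNgt; apply/negP => lt.
  have m0 : 0 <= r + h / 2 by rewrite addr_ge0// ltW// divr_gt0.
  have mq : r + h / 2 < inf S by rewrite /h; lra.
  have ma : phi (time (r + h / 2)) < phi (time x0).
    rewrite lt_neqAle phimax andbT; apply/eqP => E.
    by move: mq; rewrite ltNge ge_inf//; exists 0.
  have t0 : 0 <= inf S + h / 2 by rewrite addr_ge0// ltW// divr_gt0.
  (* A product above [c] at [inf S + h / 2] needs its first argument beyond
     [r + h / 2], hence its second one before [h]. *)
  pose c :=
    Num.max (T (phi (time x0)) (psi (time h))) (phi (time (r + h / 2))).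
  have c0 : 0 <= c by rewrite /c le_max dd_ge0 orbT.
  have : c < conv T phi psi (time (inf S + h / 2)).
    by rewrite cpsia ?gt_max ?lt ?ma// timeE// lte_fin ltrDl divr_gt0.
  move=> /(conv_gt t0 c0)[u [v [u0 v0 uv]]].
  rewrite ltNge => /negP; apply.
  have [um|mu] := leP u (r + h / 2).
    rewrite (le_trans (tnorm_le_l T (dd_itv _ _) (dd_itv _ _)))//.
    by rewrite /c le_max dd_homo_time// orbT.
  have vh : v <= h by rewrite /h in uv mu *; lra.
  rewrite /c le_max; apply/orP; left.
  by apply: tnorm_mono2; rewrite ?dd_itv// dd_homo_time.
(* The unit [psi h] of the maximum fixes the smaller value [phi r]. *)
rewrite -(tnorm_fixed_le (dd_itv _ _) (dd_itv _ _) (dd_itv _ _)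
  (phimax _) unit_h).
apply: (le_trans (conv_ge_time phi psi r0 (ltW h0))).
by rewrite cpsi0// timeE /h addrC subrK.
Qed.

(** If the supremum were only approached, the steps [kappa q (phi q)] would
    suffice for a contradiction: an early one produces a unit [e] of [phi q]
    below the supremum, and a late one, higher than [e], has a factor that
    cannot annihilate [phi] at [q] and after. *)
Lemma diagonal_attained phi :
  (forall xi, dd_le xi phi -> diagonal_on T phi xi) ->
  exists2 x0, 0 <= x0 & forall t, phi t <= phi (time x0).
Proof.
move=> diag; have [too tooE] := time_infty.
have phimax t : phi t <= phi too by apply: dd_homo; rewrite tooE leey.
apply/not_exists2P => unatt.
have lt_max x : 0 <= x -> phi (time x) < phi too.
  move=> x0; rewrite lt_neqAle phimax andbT; apply/eqP => E.
  by have [] := unatt x; apply => // t; rewrite E.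
have [q [q0 _ b0]] :=
  dd_left_gt (lexx 0) (le_lt_trans (dd_ge0 phi _) (lt_max 0 (lexx 0))).
have phiq x : 0 <= x -> forall t, (x%:E < t%:num)%E -> phi (time x) <= phi t.
  by move=> x0 t xt; apply: dd_mono; rewrite timeE.
have q10 : 0 <= q + 1 by rewrite addr_ge0.
have [psi [_ _ psib]] := diagonal_kappa diag q0 (dd_itv phi _) (phiq q q0).
(* The value of the convolution at [q + 1] already equals the one at infinity,
   so replacing [phi too] by [phi (q + 1)] does not change the product. *)
have psiooE : T (phi too) (psi too) = phi (time q) /\
  T (phi (time (q + 1))) (psi too) = phi (time q).
  have le1 : T (phi too) (psi too) <= phi (time q).
    rewrite -(psib too) ?tooE ?ltry//; apply: conv_ge.
    by rewrite tooE.
  have le2 : T (phi (time (q + 1))) (psi too) <= T (phi too) (psi too).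
    by apply: tnorm_mono2; rewrite ?dd_itv.
  have le3 : phi (time q) <= T (phi (time (q + 1))) (psi too).
    rewrite -(psib (time (q + 1))) ?timeE ?lte_fin ?ltrDl//.
    apply: sup01_le; first by apply: in01_ge0; rewrite tnorm_itv ?dd_itv.
    move=> _ [[r s] /= rs <-]; apply: tnorm_mono2; rewrite ?dd_itv//.
      by apply: dd_homo; rewrite timeE// -(timeE q10) /= -rs leeDl.
    by apply: dd_homo; rewrite tooE leey.
  by split; apply/eqP; rewrite eq_le ?le1 ?le3 ?(le_trans le3) ?(le_trans le2).
have [e [e01 be ea]] := tnorm_unit_between (dd_itv phi too)
  (dd_itv _ _) (dd_itv _ _) (dd_itv _ _) (lt_max _ q10) psiooE.1 psiooE.2.
(* Above [e], to keep [T b] from vanishing; above [phi (q + 1)], to force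
   the argument [u] of [phi] in the convolution past [q + 1]. *)
pose c := Num.max e (phi (time (q + 1))).
have c0 : 0 <= c by rewrite /c le_max dd_ge0 orbT.
have [q' [q'0 _ cq']] : exists q',
    [/\ 0 <= q', (q'%:E < too%:num)%E & c < phi (time q')].
  by apply: dd_left_gt => //; rewrite gt_max ea lt_max.
have [psi' [_ psi'0 psi'b]] :=
  diagonal_kappa diag q'0 (dd_itv phi _) (phiq q' q'0).
have q'10 : 0 <= q' + 1 by rewrite addr_ge0.
have : c < conv T phi psi' (time (q' + 1)).
  by rewrite psi'b// timeE// lte_fin ltrDl.
move=> /(conv_gt q'10 c0)[u [v [u0 v0 uv cuv]]].
have cu : c < phi (time u) by rewrite (lt_le_trans cuv)// tnorm_le_l ?dd_itv.
have cv : c < psi' (time v) by rewrite (lt_le_trans cuv)// tnorm_le_r ?dd_itv.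
have qu : q + 1 < u.
  rewrite ltNge; apply/negP => uq; move: cu; rewrite gt_max => /andP[_].
  by rewrite ltNge dd_homo_time.
have qu1 : q <= u - 1 by lra.
have u10 : 0 <= u - 1 by rewrite (le_trans q0).
(* One unit of time earlier, the step at [q'] has not yet occurred. *)
have : T (phi (time (u - 1))) (psi' (time v)) <= 0.
  apply: (le_trans (conv_ge_time phi psi' u10 v0)).
  have uvE : u - 1 + v = q' by lra.
  by rewrite uvE psi'0// timeE.
apply/negP; rewrite -ltNge (lt_le_trans b0)// -[leLHS]be.
apply: tnorm_mono2; rewrite ?dd_itv//; first exact: dd_homo_time.
by move: cv; rewrite gt_max => /andP[/ltW].
Qed.

End Time.

Theorem theorem4p10 (R : realType) (T : continuous_tnorm R)
    (phi : distance_distribution R) :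
  (forall xi : distance_distribution R, dd_le xi phi -> diagonal_on T phi xi)
  <-> one_step phi.
Proof.
split=> [diag|phi1 xi]; last exact: one_step_diagonal.
have [x0 x00 phimax] := diagonal_attained diag.
exact: attained_one_step diag x00 phimax.
Qed.
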